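(* Let $d\ge2$ and $d'\ge1$ be integers. Let $\psi_{1,d'}$ be a member of the class $\mathcal{P}(\mathbb{R}\times\mathbb{S}^{d'},|\cdot|,\theta)$. Then the function $\psi_{d,d'}:[0,\infty)\times[0,\pi]\to\mathbb{R}$ defined by $$\psi_{d,d'}(x,\theta)=\frac{2\,\Gamma(d/2)}{\sqrt{\pi}\,\Gamma((d-1)/2)}\,\frac1x\int_0^x\psi_{1,d'}(u,\theta)\left(1-\frac{u^2}{x^2}\right)^{(d-3)/2}du,\qquad x>0,$$ and $\psi_{d,d'}(0,\theta)=\psi_{1,d'}(0,\theta)$, is a member of the class $\mathcal{P}(\mathbb{R}^d\times\mathbb{S}^{d'},\|\cdot\|,\theta)$.
   Context: $\|\cdot\|$ is the Euclidean norm. $\mathbb{S}^{d'}$ is the unit sphere of $\mathbb{R}^{d'+1}$, with geodesic distance $\theta(\boldsymbol{s},\boldsymbol{s}')=\arccos\langle\boldsymbol{s},\boldsymbol{s}'\rangle$. A kernel $K:X\times X\to\mathbb{R}$ is positive definite if $\sum_{i,j=1}^N a_ia_jK(p_i,p_j)\ge0$ for all $N\in\mathbb{N}$, $a_1,\dots,a_N\in\mathbb{R}$ and $p_1,\dots,p_N\in X$. For a positive integer $d$, $\mathcal{P}(\mathbb{R}^d\times\mathbb{S}^{d'},\|\cdot\|,\theta)$ is the class of continuous $\psi:[0,\infty)\times[0,\pi]\to\mathbb{R}$ with $\psi(0,0)=1$ such that $((\boldsymbol{x},\boldsymbol{s}),(\boldsymbol{x}',\boldsymbol{s}'))\mapsto\psi(\|\boldsymbol{x}-\boldsymbol{x}'\|,\theta(\boldsymbol{s},\boldsymbol{s}'))$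 is positive definite on $\mathbb{R}^d\times\mathbb{S}^{d'}$; for $d=1$ the norm is the absolute value. *)

(* Defs.v *)
From HB Require Import structures.
From mathcomp Require Export all_boot all_order all_algebra.
From mathcomp Require Export all_classical all_reals all_analysis.
Export Order.TTheory GRing.Theory Num.Theory.
Export numFieldNormedType.Exports.

Set Implicit Arguments.
Unset Strict Implicit.
Unset Printing Implicit Defensive.

Local Open Scope classical_set_scope.
Local Open Scope ring_scope.

Definition dotv (R : realType) (n : nat) (x y : 'rV[R]_n) : R :=
  \sum_(i < n) x ord0 i * y ord0 i.

(* The library norm `|x| on 'rV[R]_n is the sup norm, hence this definition. *)
Definition enorm (R : realType) (n : nat) (x : 'rV[R]_n) : R :=
  Num.sqrt (dotv x x).

Definition sphere (R : realType) (m : nat) : set 'rV[R]_m.+1 :=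
  [set s | enorm s = 1].
Arguments sphere : clear implicits.

Definition geodesic (R : realType) (m : nat) (s t : 'rV[R]_m.+1) : R :=
  acos (dotv s t).

Definition posdef_kernel (R : realType) (T : Type) (X : set T)
    (K : T -> T -> R) : Prop :=
  forall (N : nat) (a : 'I_N -> R) (p : 'I_N -> T),
    (forall i, X (p i)) ->
    0 <= \sum_(i < N) \sum_(j < N) a i * a j * K (p i) (p j).

(* The class P(V x S^m, nrm, geodesic) of radial profiles on [0,oo) x [0,pi];
   profiles are total functions whose values off this domain are irrelevant. *)
Definition classP (R : realType) (V : zmodType) (nrm : V -> R) (m : nat)
    (psi : R -> R -> R) : Prop :=
  [/\ {within `[0, +oo[%classic `*` `[0, pi]%classic,
         continuous (fun q : R * R => psi q.1 q.2)},
      psi 0 0 = 1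
    & posdef_kernel ([set: V] `*` sphere R m)
        (fun p q => psi (nrm (p.1 - q.1)) (geodesic p.2 q.2))].

(* Meaningful for 0 < a, where Euler's integral converges. *)
Definition Gamma (R : realType) (a : R) : R :=
  \int[lebesgue_measure]_(t in `]0, +oo[) (t `^ (a - 1) * expR (- t)).

(* Lebesgue integral; for d = 2 the weight is singular at u = x, an endpoint
   of measure zero where powR takes the value 0. *)
Definition turning_bands (R : realType) (d : nat) (psi : R -> R -> R)
    (x theta : R) : R :=
  if 0 < x then
    2 * Gamma (d%:R / 2) / (Num.sqrt pi * Gamma ((d%:R - 1) / 2)) *
    (x^-1 * \int[lebesgue_measure]_(u in `[0, x])
              (psi u theta * (1 - u ^+ 2 / x ^+ 2) `^ ((d%:R - 3) / 2)))
  else psi 0 theta.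

(* Main.v *)
(* The integral defining [turning_bands d psi x theta] is the mean of
   [psi |x <w, u>| theta] over the unit vectors [w] of R^d, for any fixed unit
   vector [u]. It is handled through
   its one-dimensional marginal, of density proportional to [(1 - r ^ 2) ^ e]
   with [e = (d - 3) / 2], and no measure on the sphere is needed: positive
   definiteness of these means, for every exponent [e > (d - 3) / 2], goes by
   induction on [d]. The weight [(1 - p ^ 2 - z ^ 2) ^ (e - 1 / 2)] on the unit
   disk is rotation invariant and has marginal proportional to
   [(1 - p ^ 2) ^ e], so
     \int F (|y| p) (1 - p ^ 2) ^ e dp
   is, up to a positive constant, the disk integral of [F (|y'| p + t z)] for
   [y = (t, y')]; for fixed [z] the fibre integral is of the same kind in
   dimension [d - 1], with exponent [e - 1 / 2] and the shifted function
   [F (_ + t z)]. In dimension 1 the positivity is pointwise. The exponent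
   [(d - 3) / 2] itself is reached by dominated convergence. *)
Require Import Defs.
From mathcomp Require Import ring lra measurable_realfun.
Set Implicit Arguments.
Unset Strict Implicit.
Unset Printing Implicit Defensive.
Local Open Scope classical_set_scope.
Local Open Scope ring_scope.

(** * Linear substitutions in Lebesgue integrals *)

Section Lebesgue_substitution.
Context {R : realType}.
Local Notation mu := (@lebesgue_measure R).
Local Open Scope ereal_scope.

(** The image of [mu] under [c * x + b], multiplied by [c], agrees with [mu] on half-open intervals,
    hence is [mu] by uniqueness of Lebesgue measure. *)
Lemma ge0_integral_scale_shift (c b : R) (g : R -> \bar R) : (0 < c)%R ->
  measurable_fun setT g -> (forall x, 0 <= g x) ->
  c%:E * \int[mu]_x g (c * x + b)%R = \int[mu]_x g x.
Proof.
move=> c0 mg g0.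
pose phi := (fun x : R => (c * x + b)%R) : measurableTypeR R -> measurableTypeR R.
have mphi : measurable_fun setT phi.
  apply: measurable_funD => //; exact: measurable_funM.
have iphi a : phi a = (c * a + b)%R by [].
have -> : \int[mu]_x g x = \int[mscale (NngNum (ltW c0)) (pushforward mu phi)]_x g x.
  move=> m; apply: eq_measure_integral => //= A mA _.
  apply: lebesgue_measure_unique => // _ [[a b']] _ <-.
  have E : (phi @^-1` `]a, b'] = `]((a - b) / c)%R, ((b' - b) / c)%R])%classic.
    apply/seteqP; split=> x /=; rewrite !in_itv/= iphi;
      rewrite ltr_pdivrMr// ler_pdivlMr// ltrBlDr lerBrDr (mulrC x)//.
  transitivity (c%:E * mu (phi @^-1` `]a, b'])%classic); last by [].
  rewrite E !lebesgue_measure_itv/= !lte_fin ltr_pM2r ?invr_gt0// ltrD2r.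
  case: ifP => _; last by rewrite mule0.
  rewrite -!EFinB -EFinM; congr (_%:E); field; exact: lt0r_neq0.
rewrite ge0_integral_mscale//; congr (_ * _).
by rewrite ge0_integral_pushforward.
Qed.

Lemma ge0_integral_shift (b : R) (g : R -> \bar R) :
  measurable_fun setT g -> (forall x, 0 <= g x) ->
  \int[mu]_x g (x + b)%R = \int[mu]_x g x.
Proof.
move=> mg g0; rewrite -(ge0_integral_scale_shift b ltr01 mg g0) mul1e.
by under [RHS]eq_integral do rewrite mul1r.
Qed.

Lemma ge0_integral_scale (c : R) (g : R -> \bar R) : (0 < c)%R ->
  measurable_fun setT g -> (forall x, 0 <= g x) ->
  c%:E * \int[mu]_x g (c * x)%R = \int[mu]_x g x.
Proof.
move=> c0 mg g0; rewrite -(ge0_integral_scale_shift 0 c0 mg g0).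
by under [in RHS]eq_integral do rewrite addr0.
Qed.

Lemma ge0_integral_opp (g : R -> \bar R) :
  measurable_fun setT g -> (forall x, 0 <= g x) ->
  \int[mu]_x g (- x)%R = \int[mu]_x g x.
Proof.
move=> mg g0.
have -> : \int[mu]_x g x = \int[pushforward mu (-%R : _ -> measurableTypeR R)]_x g x.
  by apply: eq_measure_integral => //= A mA _; rewrite lebesgue_measureN.
by rewrite ge0_integral_pushforward.
Qed.

Implicit Types g : R * R -> \bar R.

Lemma measurable_lin2 (a b c d : R) :
  measurable_fun setT (fun x : R * R => (a * x.1 + b * x.2, c * x.1 + d * x.2)%R).
Proof.
by apply/measurable_fun_pairP; split => /=;
  apply: measurable_funD; apply: measurable_funM.
Qed.

Lemma integral_swap g : measurable_fun setT g -> (forall x, 0 <= g x) ->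
  \int[mu]_z \int[mu]_p g (p, z) = \int[mu]_p \int[mu]_z g (p, z).
Proof.
move=> mg g0.
exact: (esym (@fubini_tonelli _ _ (measurableTypeR R) (measurableTypeR R) R
  mu mu g mg g0)).
Qed.

Lemma integral_shear1 (t : R) g : measurable_fun setT g -> (forall x, 0 <= g x) ->
  \int[mu]_z \int[mu]_p g (p + t * z, z)%R = \int[mu]_z \int[mu]_p g (p, z).
Proof.
move=> mg g0; apply: eq_integral => z _.
rewrite (@ge0_integral_shift (t * z)%R (fun p => g (p, z)))//.
exact: measurableT_comp.
Qed.

(** The sheared variable is the outer one, so Tonelli is applied before and after the
    translation. *)
Lemma integral_shear2 (s : R) g : measurable_fun setT g -> (forall x, 0 <= g x) ->
  \int[mu]_z \int[mu]_p g (p, z + s * p)%R = \int[mu]_z \int[mu]_p g (p, z).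
Proof.
move=> mg g0.
have mgs : measurable_fun setT (fun x : R * R => g (x.1, x.2 + s * x.1)%R).
  apply: measurableT_comp => //.
  have := measurable_lin2 1 0 s 1.
  by under eq_fun do rewrite !mul1r mul0r addr0 [(_ + snd _)%R]addrC.
transitivity (\int[mu]_p \int[mu]_z g (p, z + s * p)%R).
  exact: (integral_swap mgs (fun x => g0 _)).
transitivity (\int[mu]_p \int[mu]_z g (p, z)); last first.
  exact: (esym (integral_swap mg g0)).
apply: eq_integral => p _.
rewrite (@ge0_integral_shift (s * p)%R (fun z => g (p, z)))//.
exact: measurableT_comp.
Qed.

(* A rotation is a product of three shears. *)
Lemma integral_rotation (c s : R) g : (c ^+ 2 + s ^+ 2 = 1)%R -> s != 0%R ->
  measurable_fun setT g -> (forall x, 0 <= g x) ->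
  \int[mu]_z \int[mu]_p g (c * p + s * z, - s * p + c * z)%R =
  \int[mu]_z \int[mu]_p g (p, z).
Proof.
move=> cs s0 mg g0.
(* If [c] and [s] are the cosine and sine of an angle, [t] is the tangent of its half. The rotation
   is the shear by [t] in the first variable, by [- s] in the second, and by [t] in the first
   again. *)
pose t := ((1 - c) / s)%R.
pose g1 x := g (x.1 + t * x.2, x.2)%R.
have mg1 : measurable_fun setT g1.
  apply: measurableT_comp => //.
  by have := measurable_lin2 1 t 0 1;
    under eq_fun do rewrite !mul1r mul0r add0r.
pose g2 x := g1 (x.1, x.2 + (- s) * x.1)%R.
have mg2 : measurable_fun setT g2.
  apply: measurableT_comp => //.
  have := measurable_lin2 1 0 (- s) 1;
    by under eq_fun do rewrite !mul1r mul0r addr0 [(_ + snd _)%R]addrC.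
transitivity (\int[mu]_z \int[mu]_p g2 (p + t * z, z)%R); last first.
  transitivity (\int[mu]_z \int[mu]_p g2 (p, z)).
    exact: (integral_shear1 t mg2 (fun x => g0 _)).
  transitivity (\int[mu]_z \int[mu]_p g1 (p, z)).
    exact: (integral_shear2 (- s) mg1 (fun x => g0 _)).
  exact: (integral_shear1 t mg g0).
apply: eq_integral => z _; apply: eq_integral => p _.
rewrite /g2 /g1/=; congr (g (_, _)).
  (* A term that vanishes by [cs] is inserted, so that [field] closes what is left without that
     relation. *)
  rewrite /t; transitivity (c * p + s * z + (1 - c^+2 - s^+2) / s * z)%R.
    by rewrite -{1}cs [X in (X / s)%R](_ : _ = 0)%R ?mul0r ?addr0//; ring.
  by field.
by rewrite /t; field.
Qed.

End Lebesgue_substitution.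

(** * The weight [(1 - r ^ 2) ^ e] and its disk extension *)

Section ppow.
Context {R : realType}.
Local Notation mu := (@lebesgue_measure R).

(* [s `^ e] is 1 for [s < 0], and [0 `^ 0] is 1: both are truncated to 0. *)
Definition ppow (e s : R) : R := if 0 < s then s `^ e else 0.

Lemma ppow_ge0 e s : 0 <= ppow e s.
Proof. by rewrite /ppow; case: ifP => // _; exact: powR_ge0. Qed.

Lemma measurable_ppow e : measurable_fun setT (ppow e).
Proof.
have m0 : measurable_fun setT (fun s : R => 0 < s) by exact: measurable_fun_ltr.
exact: (measurable_fun_ifT m0 (measurable_powR e) (measurable_cst _)).
Qed.

Lemma ppow_eq0 e s : s <= 0 -> ppow e s = 0.
Proof. by rewrite /ppow leNgt => /negbTE ->. Qed.

Lemma ppowM e s t : 0 < s -> ppow e (s * t) = s `^ e * ppow e t.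
Proof.
move=> s0; rewrite /ppow pmulr_rgt0//; case: ifP => t0; last by rewrite mulr0.
by rewrite powRM// ltW.
Qed.

Local Open Scope ereal_scope.

(** The Beta integral B(1/2, e + 1), finite for e > -1. As an extended real it is positive for every
    [e]. *)
Definition Vol (e : R) : \bar R := \int[mu]_r (ppow e (1 - r ^+ 2))%:E.

Lemma measurable_ppowB d (T : measurableType d) (e : R) (f : T -> R) (g : T -> R) :
  measurable_fun setT f -> measurable_fun setT g ->
  measurable_fun setT (fun x => ppow e (f x - g x ^+ 2)).
Proof.
move=> mf mg; apply: measurableT_comp; first exact: measurable_ppow.
by apply: measurable_funB => //; apply: measurable_funX.
Qed.

(** For s > 0 substitute p = sqrt(s) r: the weight yields the factor s ^ e and the Jacobian raises
    the exponent by 1/2. For s <= 0 both sides vanish. *)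
Lemma integral_ppow_fiber (e s : R) (F : R -> R) :
  measurable_fun setT F -> (forall x, 0 <= F x)%R ->
  \int[mu]_p (F p * ppow e (s - p ^+ 2))%:E =
  (ppow (e + 2^-1) s)%:E *
  \int[mu]_r (F (Num.sqrt s * r) * ppow e (1 - r ^+ 2))%:E.
Proof.
move=> mF F0; have [s0|s0] := ltP 0%R s; last first.
  rewrite ppow_eq0// mul0e integral0_eq// => x _.
  by rewrite ppow_eq0 ?mulr0// subr_le0 (le_trans s0)// sqr_ge0.
have q0 : (0 < Num.sqrt s)%R by rewrite sqrtr_gt0.
rewrite -(ge0_integral_scale q0); last 2 first.
- apply/measurable_EFinP/measurable_funM => //.
  exact: (@measurable_ppowB _ _ e (cst s) id).
- by move=> x; rewrite lee_fin mulr_ge0// ppow_ge0.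
under eq_integral => r _.
  rewrite exprMn sqr_sqrtr ?ltW// -[X in (X - _)%R](mulr1 s) -mulrBr ppowM//.
  rewrite mulrCA EFinM.
over.
rewrite ge0_integralZl_EFin//; last 3 first.
- by move=> x _; rewrite lee_fin mulr_ge0// ppow_ge0.
- apply/measurable_EFinP/measurable_funM => //; last first.
    exact: (@measurable_ppowB _ _ e (cst 1%R) id).
  apply: measurableT_comp => //; exact: measurable_funM.
- exact: powR_ge0.
rewrite muleA -EFinM; congr (_%:E * _).
rewrite /ppow s0 powRD; last by rewrite (gt_eqF s0) implybT.
by rewrite powR12_sqrt ?ltW// mulrC.
Qed.

(** The weight on the disk is rotation invariant, so the linear form a p + t z may be rotated into
    rho p. Then [F] no longer depends on z, and integrating z out leaves the marginal weight. *)
Lemma disk_marginal (e a t rho : R) (F : R -> R) :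
  measurable_fun setT F -> (forall x, 0 <= F x)%R ->
  (0 <= a)%R -> (0 <= rho)%R -> (rho ^+ 2 = a ^+ 2 + t ^+ 2)%R ->
  \int[mu]_z \int[mu]_p (F (a * p + t * z) * ppow e (1 - z ^+ 2 - p ^+ 2))%:E =
  \int[mu]_p (F (rho * p) * ppow (e + 2^-1) (1 - p ^+ 2))%:E * Vol e.
Proof.
move=> mF F0 a0 rho0 rhoE.
have mFr : measurable_fun setT (fun p : R => F (rho * p)%R).
  by apply: measurableT_comp => //; exact: measurable_funM.
pose g (x : R * R) := (F (rho * x.1) * ppow e (1 - x.2 ^+ 2 - x.1 ^+ 2))%:E.
have mg : measurable_fun setT g.
  apply/measurable_EFinP/measurable_funM.
    exact: (@measurableT_comp _ _ _ _ _ _ _ _ fst mFr).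
  apply: (@measurable_ppowB _ _ e (fun x : R * R => 1 - x.2 ^+ 2)%R fst) => //.
  by apply: measurable_funB => //; exact: measurable_funX.
have g0 x : 0 <= g x by rewrite lee_fin mulr_ge0// ppow_ge0.
transitivity (\int[mu]_z \int[mu]_p g (p, z)).
  (* For t = 0 no rotation is required; otherwise its sine t / rho is nonzero, as
     [integral_rotation] demands. *)
  have [t0|t0] := eqVneq t 0%R.
    have -> : a = rho.
      move: rhoE; rewrite t0 expr0n/= addr0 => /eqP.
      by rewrite eqrXn2// => /eqP.
    apply: eq_integral => z _; apply: eq_integral => p _.
    by rewrite /g/= t0 mul0r addr0.
  have r0 : rho != 0%R.
    apply: contra_neq t0 => r0; move: rhoE; rewrite r0 expr0n/= => /esym/eqP.
    by rewrite paddr_eq0 ?sqr_ge0// !sqrf_eq0 => /andP[_ /eqP].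
  transitivity (\int[mu]_z \int[mu]_p
      g (a / rho * p + t / rho * z, - (t / rho) * p + a / rho * z)%R).
    apply: eq_integral => z _; apply: eq_integral => p _.
    rewrite /g/=; congr (F _ * ppow e _)%:E; first by field.
    transitivity (1 - (p ^+ 2 + z ^+ 2) * ((a ^+ 2 + t ^+ 2) / rho ^+ 2))%R.
      by rewrite -rhoE divff ?sqrf_eq0//; ring.
    by field.
  apply: integral_rotation => //; last by rewrite mulf_neq0 ?invr_eq0.
  by rewrite !expr_div_n -mulrDl -rhoE divff ?sqrf_eq0.
rewrite (integral_swap mg g0).
under eq_integral => p _.
  rewrite /g/=.
  under eq_integral => z _ do rewrite addrAC.
  rewrite (integral_ppow_fiber e (1 - p ^+ 2) (measurable_cst (F (rho * p)%R)) (fun=> F0 _)).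
  under eq_integral => z _ do rewrite /= EFinM.
  rewrite ge0_integralZl_EFin//; last 2 first.
  - by move=> x _; rewrite lee_fin ppow_ge0.
  - by apply/measurable_EFinP; exact: (@measurable_ppowB _ _ e (cst 1%R) id).
  rewrite muleA -EFinM mulrC.
over.
rewrite ge0_integralZr//.
- apply/measurable_EFinP/measurable_funM => //.
  exact: (@measurable_ppowB _ _ _ (cst 1%R) id).
- by move=> x _; rewrite lee_fin mulr_ge0// ppow_ge0.
- by apply: integral_ge0 => x _; rewrite lee_fin ppow_ge0.
Qed.

(** The second evaluation of the disk integral of [disk_marginal]: the chord at height z is rescaled
    to [-1, 1]. Equating the two lowers the dimension by one. *)
Lemma disk_fibers (e a t : R) (F : R -> R) :
  measurable_fun setT F -> (forall x, 0 <= F x)%R ->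
  \int[mu]_z \int[mu]_p (F (a * p + t * z) * ppow e (1 - z ^+ 2 - p ^+ 2))%:E =
  \int[mu]_z ((ppow (e + 2^-1) (1 - z ^+ 2))%:E *
    \int[mu]_r (F (a * Num.sqrt (1 - z ^+ 2) * r + t * z) * ppow e (1 - r ^+ 2))%:E).
Proof.
move=> mF F0; apply: eq_integral => z _.
rewrite (@integral_ppow_fiber e (1 - z ^+ 2) (fun p : R => F (a * p + t * z)%R))//.
  by under eq_integral => r _ do rewrite mulrA.
by apply: measurableT_comp => //; apply: measurable_funD => //; exact: measurable_funM.
Qed.

Lemma measurable_disk_fiber (e a t : R) (F : R -> R) :
  measurable_fun setT F -> (forall x, 0 <= F x)%R ->
  measurable_fun setT (fun z : R => \int[mu]_r
    (F (a * Num.sqrt (1 - z ^+ 2) * r + t * z) * ppow e (1 - r ^+ 2))%:E).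
Proof.
move=> mF F0.
pose h (x : R * R) := (F (a * Num.sqrt (1 - x.1 ^+ 2) * x.2 + t * x.1) *
  ppow e (1 - x.2 ^+ 2))%:E.
apply: (@measurable_fun_fubini_tonelli_F _ _ (measurableTypeR R) (measurableTypeR R) R mu h).
- apply/measurable_EFinP/measurable_funM; last first.
    exact: (@measurable_ppowB _ _ e (cst 1%R) snd).
  apply: measurableT_comp => //; apply: measurable_funD; last exact: measurable_funM.
  apply: measurable_funM => //; apply: measurable_funM => //.
  apply: (@measurableT_comp _ _ _ _ _ _ (@Num.sqrt R)).
    by apply: continuous_measurable_fun; exact: sqrt_continuous.
  by apply: measurable_funB => //; exact: measurable_funX.
- by move=> x; rewrite lee_fin mulr_ge0// ppow_ge0.
Qed.

End ppow.

(** * Total mass of the weight and Euler integrals *)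

Section Vol.
Context {R : realType}.
Local Notation mu := (@lebesgue_measure R).
Local Open Scope ereal_scope.

(** A zero integral would make [f] vanish off a null set, which would then contain the interval ]a,
    b[ of positive length. *)
Lemma ge0_integral_gt0 (f : R -> \bar R) (a b : R) : (a < b)%R ->
  measurable_fun setT f -> (forall x, 0 <= f x) ->
  (forall x, (a < x < b)%R -> 0 < f x) -> 0 < \int[mu]_x f x.
Proof.
move=> ab mf f0 fab; rewrite lt0e integral_ge0// andbT.
apply/eqP => I0.
have [+ _] := @ae_eq_integral_abs _ (measurableTypeR R) R mu setT measurableT f mf.
have -> : \int[mu]_(x in setT) `|f x| = 0.
  by rewrite -[RHS]I0; apply: eq_integral => x _; rewrite gee0_abs.
move=> /(_ erefl)[N [mN N0 abN]].
have : mu `]a, b[ <= mu N.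
  apply: le_measure; rewrite ?inE// => x /=; rewrite in_itv/= => xab.
  by apply: abN => /= /(_ I) fx0; have := fab _ xab; rewrite fx0 ltxx.
by rewrite N0 lebesgue_measure_itv/= lte_fin ab -EFinB lee_fin subr_le0 leNgt ab.
Qed.

Lemma measurable_ppow1 (e : R) : measurable_fun setT (fun r : R => (ppow e (1 - r ^+ 2))%:E).
Proof. by apply/measurable_EFinP; exact: (@measurable_ppowB _ _ _ e (cst 1%R) id). Qed.

Lemma Vol_gt0 (e : R) : 0 < Vol e.
Proof.
apply: (@ge0_integral_gt0 _ 0 1) => //; first exact: measurable_ppow1.
  by move=> x; rewrite lee_fin ppow_ge0.
move=> x /andP[x0 x1]; rewrite lte_fin /ppow subr_gt0 expr_lt1 ?ltW//.
by rewrite x1 powR_gt0// subr_gt0 expr_lt1 ?ltW.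
Qed.

(** The bound does not depend on [a], so it survives the limit a -> 0. It comes from the
    antiderivative, whose value at [a] is nonnegative and is dropped. *)
Lemma integral_powR_segment (e a : R) : (-1 < e)%R -> (0 < a < 1)%R ->
  \int[mu]_(x in `[a, 1%R]) (x `^ e)%:E <= ((e + 1)^-1)%:E.
Proof.
move=> e1 /andP[a0 a1].
have e1' : (e + 1 != 0)%R by lra.
pose F (x : R) := ((e + 1)^-1 * x `^ (e + 1))%R.
have dF x : (0 < x)%R -> derivable F x 1.
  move=> x0; apply: derivableM; first exact: derivable_cst.
  by apply: derivable_powR; rewrite in_itv/= x0.
have cF x : (0 < x)%R -> {for x, continuous F}.
  by move=> x0; apply/differentiable_continuous/derivable1_diffP/dF.
have cp x : (0 < x)%R -> {for x, continuous (fun x : R => x `^ e)%R}.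
  move=> x0; apply/differentiable_continuous/derivable1_diffP.
  by apply: derivable_powR; rewrite in_itv/= x0.
rewrite (@continuous_FTC2 _ _ F _ _ a1).
- rewrite /F powR1 mulr1 -EFinB lee_fin gerBl mulr_ge0 ?powR_ge0//.
  by rewrite invr_ge0; lra.
- apply: continuous_in_subspaceT => x /[!inE]/=; rewrite in_itv/= => /andP[ax _].
  exact: cp (lt_le_trans a0 ax).
- split.
  + by move=> x; rewrite in_itv/= => /andP[ax _]; apply: dF (lt_trans a0 ax).
  + exact: cvg_at_right_filter (cF _ a0).
  + exact: cvg_at_left_filter (cF _ ltr01).
- move=> x; rewrite in_itv/= => /andP[ax _].
  have x0 : (0 < x)%R by apply: lt_trans ax.
  rewrite derive1E deriveZ//=; last by apply: derivable_powR; rewrite in_itv/= x0.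
  rewrite -derive1E powR_derive1 ?in_itv/= ?x0// addrK.
  by rewrite /GRing.scale/= mulrA mulVf// mul1r.
Qed.

Lemma integral_powR_lty (e : R) : (-1 < e)%R ->
  \int[mu]_(x in `]0%R, 1%R]) (x `^ e)%:E < +oo.
Proof.
(* The left ends start at 1/2, since [integral_powR_segment] needs them below 1. *)
move=> e1; pose A (n : nat) : set R := `[(n.+2%:R^-1)%R, 1%R]%classic.
have -> : `]0%R, 1%R]%classic = \bigcup_n A n.
  apply/seteqP; split=> x /=; rewrite in_itv/=.
  - move=> /andP[x0 x1]; exists (Num.truncn x^-1) => //.
    rewrite /A/= in_itv/= x1 andbT invf_ple ?posrE//.
    rewrite ltW// (lt_trans (truncnS_gt _))// ltr_nat//.
  - move=> [n _]; rewrite /A/= in_itv/= => /andP[nx ->].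
    by rewrite andbT (lt_le_trans _ nx)// invr_gt0.
have mp (B : set R) : measurable_fun B (fun x : R => (x `^ e)%:E).
  apply: measurable_funTS; apply/measurable_EFinP; exact: measurable_powR.
have ndA : nondecreasing_seq A.
  move=> m n mn; rewrite subsetEset => x; rewrite /A/= !in_itv/= => /andP[mx ->].
  by rewrite andbT (le_trans _ mx)// lef_pV2 ?posrE// ler_nat.
have mA n : measurable (A n) by exact: measurable_itv.
have p0 n x : A n x -> 0 <= (x `^ e)%:E by rewrite lee_fin powR_ge0.
have := @ge0_nondecreasing_set_cvg_integral _ (measurableTypeR R) R A _ mu ndA mA (fun=> mp _) p0.
move=> cvgA; apply: (@le_lt_trans _ _ ((e + 1)^-1)%:E); last exact: ltry.
apply: (cvge_to_le cvgA); apply: nearW => n; apply: integral_powR_segment => //.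
by rewrite invr_gt0 ltr0n/= invf_lt1// ltr1n.
Qed.

Lemma Vol_lty (e : R) : (-1 < e)%R -> Vol e < +oo.
Proof.
(* As 1 - r ^ 2 is at most 1, lowering the exponent to [e'] only increases the power. As [e'] is
   nonpositive, 1 - |r| <= 1 - r ^ 2 then gives the upper bound (1 - |r|) ^ e'. *)
move=> e1; pose e' := Num.min e 0%R.
have e'1 : (-1 < e')%R by rewrite lt_min e1/= ltrN10.
pose q (u : R) := (((fun x : R => x `^ e')%R \_ `]0%R, 1%R]) u)%:E.
have mq : measurable_fun setT q.
  apply/measurable_EFinP; apply/(measurable_restrictT _ _).1 => //.
  by apply: measurable_funTS; exact: measurable_powR.
have q0 u : 0 <= q u.
  by rewrite lee_fin; apply: restrict_ge0 => x _; exact: powR_ge0.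
have Iq : \int[mu]_x q x < +oo.
  apply: le_lt_trans (integral_powR_lty e'1).
  by rewrite [leRHS]integral_mkcond restrict_EFin.
have mq1 : measurable_fun setT (fun r : R => q (r + 1)%R).
  by apply: measurableT_comp => //; exact: measurable_funD.
have mq2 : measurable_fun setT (fun r : R => q (- r + 1)%R).
  apply: measurableT_comp => //; exact: measurable_funD.
(* One term dominates the weight on ]-1, 0[, the other on [0, 1[; both have the integral of [q]. *)
apply: (@le_lt_trans _ _ (\int[mu]_r (q (r + 1)%R + q (- r + 1)%R))).
  apply: ge0_le_integral => //.
  - by move=> r _; rewrite lee_fin ppow_ge0.
  - exact: measurable_ppow1.
  - exact: (emeasurable_funD mq1 mq2).
  move=> r _; rewrite /ppow subr_gt0; case: ifP => [r1|_]; last by rewrite adde_ge0.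
  have nr1 : (`|r| < 1)%R by rewrite -(@expr_lt1 _ 2)// real_normK ?num_real.
  have s0 : (0 < 1 - r ^+ 2)%R by rewrite subr_gt0.
  have s1 : (1 - r ^+ 2 <= 1)%R by rewrite gerBl sqr_ge0.
  have key : ((1 - r ^+ 2) `^ e <= (1 - `|r|) `^ e')%R.
    apply: (@le_trans _ _ ((1 - r ^+ 2) `^ e')%R).
      by apply: ger_powR; rewrite ?s0// ge_min lexx.
    have [->|ne'] := eqVneq e' 0%R; first by rewrite !powRr0.
    have e'0 : (e' <= 0)%R by rewrite ge_min lexx orbT.
    rewrite -[e']opprK [leLHS]powRN [leRHS]powRN lef_pV2 ?posrE ?powR_gt0 ?subr_gt0//.
    have rr : (1 - `|r| <= 1 - r ^+ 2)%R.
      rewrite lerD2l lerN2 -real_normK ?num_real// expr2.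
      by rewrite ler_piMr// ltW.
    by apply: (ge0_ler_powR _ _ _ rr); rewrite ?oppr_ge0// nnegrE ?subr_ge0 ltW.
  have [r0|r0] := leP 0%R r.
  - apply: (@le_trans _ _ (q (- r + 1)%R)); last by rewrite leeDr.
    rewrite lee_fin patchE mem_set//=.
      by rewrite (le_trans key)// ger0_norm// addrC.
    by move: nr1; rewrite in_itv/= ger0_norm// => nr1; apply/andP; split; lra.
  - apply: (@le_trans _ _ (q (r + 1)%R)); last by rewrite leeDl.
    rewrite lee_fin patchE mem_set//=.
      by rewrite (le_trans key)// ltr0_norm// opprK addrC.
    by move: nr1; rewrite in_itv/= ltr0_norm// => nr1; apply/andP; split; lra.
rewrite ge0_integralD//.
rewrite (@ge0_integral_shift _ 1 q)//.
rewrite (@ge0_integral_opp _ (fun r => q (r + 1)%R))//.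
by rewrite (@ge0_integral_shift _ 1 q)// lte_add_pinfty.
Qed.

(* Euler's integral as an extended real; [Gamma] is its finite part. *)
Definition Gint (b : R) : \bar R := \int[mu]_t (ppow (b - 1) t * expR (- t))%:E.

Lemma measurable_Gint (b : R) :
  measurable_fun setT (fun t : R => (ppow (b - 1) t * expR (- t))%:E).
Proof.
apply/measurable_EFinP/measurable_funM; first exact: measurable_ppow.
by apply: measurableT_comp => //; exact: measurable_funN.
Qed.

Lemma Gint_gt0 (b : R) : 0 < Gint b.
Proof.
apply: (@ge0_integral_gt0 _ 0 1) => //; first exact: measurable_Gint.
  by move=> x; rewrite lee_fin mulr_ge0 ?ppow_ge0 ?expR_ge0.
move=> x /andP[x0 x1]; rewrite lte_fin mulr_gt0 ?expR_gt0//.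
by rewrite /ppow x0 powR_gt0.
Qed.

Lemma GammaE (b : R) : Gamma b = fine (Gint b).
Proof.
rewrite /Gamma /Gint /Rintegral integral_mkcond; congr fine.
apply: eq_integral => t _; rewrite patchE /ppow.
have [t0|t0] := ltP 0%R t; first by rewrite mem_set//= in_itv/= t0.
by rewrite memNset ?mul0r//= in_itv/= andbT ltNge t0.
Qed.

Lemma Gint1_lty : Gint 1 < +oo.
Proof.
apply: (@le_lt_trans _ _ (\int[mu]_x (exponential_pdf 1 x)%:E)); last first.
  by rewrite integral_exponential_pdf ?ltry.
apply: ge0_le_integral => //.
- by move=> x _; rewrite lee_fin mulr_ge0 ?ppow_ge0 ?expR_ge0.
- exact: measurable_Gint.
- by apply/measurable_EFinP; exact: measurable_exponential_pdf.
move=> x _; rewrite lee_fin /ppow subrr powRr0.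
have [x0|x0] := ltP 0%R x; last by rewrite mul0r exponential_pdf_ge0.
rewrite /exponential_pdf patchE mem_set; last by rewrite /= in_itv/= ltW.
by rewrite /= !mul1r mulN1r.
Qed.

(* The substitution [t = v - s ^ 2] in the product of a Gaussian integral and
   an Euler integral. *)
Lemma Gint_Vol (b : R) :
  (Num.sqrt pi)%:E * Gint b = Gint (b + 2^-1) * Vol (b - 1).
Proof.
pose h (x : R * R) := (ppow (b - 1) (x.2 - x.1 ^+ 2) * expR (- x.2))%:E.
have mh : measurable_fun setT h.
  apply/measurable_EFinP/measurable_funM.
    exact: (@measurable_ppowB _ _ _ _ snd fst).
  by apply: measurableT_comp => //; exact: measurable_funN.
have h0 x : 0 <= h x by rewrite lee_fin mulr_ge0 ?ppow_ge0 ?expR_ge0.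
transitivity (\int[mu]_s \int[mu]_v h (s, v)).
  rewrite -integralT_gauss -ge0_integralZr//; last 3 first.
  - by apply/measurable_EFinP; exact: measurable_gauss_fun.
  - by move=> x _; rewrite lee_fin gauss_fun_ge0.
  - exact/ltW/Gint_gt0.
  apply: eq_integral => s _.
  rewrite -ge0_integralZl_EFin ?gauss_fun_ge0//; last 2 first.
  - by move=> x _; rewrite lee_fin mulr_ge0 ?ppow_ge0 ?expR_ge0.
  - exact: measurable_Gint.
  rewrite -[RHS](@ge0_integral_shift _ (s ^+ 2) (fun v => h (s, v)))//; last first.
    exact: measurableT_comp.
  apply: eq_integral => t _; rewrite /h/= addrK -EFinM; congr EFin.
  by rewrite mulrCA /gauss_fun -expRD opprD [(- t + _)%R]addrC.
(* For fixed v the integral over s ^ 2 < v is a fibre integral: it gives v ^ (b - 1/2) times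
   [Vol (b - 1)]. *)
transitivity (\int[mu]_v \int[mu]_s h (s, v)).
  exact: (esym (integral_swap mh h0)).
rewrite /Gint -ge0_integralZr//; last 3 first.
- exact: measurable_Gint.
- by move=> x _; rewrite lee_fin mulr_ge0 ?ppow_ge0 ?expR_ge0.
- exact/ltW/Vol_gt0.
apply: eq_integral => v _; rewrite /h/=.
under eq_integral => s _ do rewrite mulrC.
rewrite (integral_ppow_fiber (b - 1) v (measurable_cst (expR (- v))) (fun=> expR_ge0 _)).
under eq_integral => s _ do rewrite /= EFinM.
rewrite ge0_integralZl_EFin//; last 2 first.
- by move=> x _; rewrite lee_fin ppow_ge0.
- exact: measurable_ppow1.
by rewrite muleA -EFinM; congr ((ppow _ _ * _)%:E * _); ring.
Qed.

End Vol.

(** * Positivity of the weighted means by induction on the dimension *)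

Section norms.
Context {R : realType}.

Lemma dotvv_ge0 n (x : 'rV[R]_n) : 0 <= dotv x x.
Proof. by apply: sumr_ge0 => i _; rewrite -expr2 sqr_ge0. Qed.

Lemma enorm_ge0 n (x : 'rV[R]_n) : 0 <= enorm x.
Proof. exact: sqrtr_ge0. Qed.

Lemma sqr_enorm n (x : 'rV[R]_n) : enorm x ^+ 2 = dotv x x.
Proof. by rewrite sqr_sqrtr// dotvv_ge0. Qed.

Definition tailv n (x : 'rV[R]_n.+1) : 'rV[R]_n := \row_i x ord0 (lift ord0 i).

Lemma tailvB n (x y : 'rV[R]_n.+1) : tailv (x - y) = tailv x - tailv y.
Proof. by apply/rowP => i; rewrite !mxE. Qed.

Lemma sqr_enorm_tailv n (x : 'rV[R]_n.+1) :
  enorm x ^+ 2 = enorm (tailv x) ^+ 2 + x ord0 ord0 ^+ 2.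
Proof.
rewrite !sqr_enorm /dotv big_ord_recl addrC -expr2; congr (_ + _).
by apply: eq_bigr => i _; rewrite !mxE.
Qed.

Lemma enormZ n (c : R) (x : 'rV[R]_n) : 0 <= c -> enorm (c *: x) = c * enorm x.
Proof.
move=> c0; have -> : c * enorm x = Num.sqrt (c ^+ 2) * enorm x.
  by rewrite sqrtr_sqr ger0_norm.
rewrite -sqrtrM ?sqr_ge0//; congr (Num.sqrt _).
by rewrite /dotv mulr_sumr; apply: eq_bigr => i _; rewrite !mxE; ring.
Qed.

Lemma enorm1E (x : 'rV[R]_1) : enorm x = `|x ord0 ord0|.
Proof. by rewrite /enorm /dotv big_ord1 -expr2 sqrtr_sqr. Qed.

End norms.

Section band_positivity.
Context {R : realType}.
Local Notation mu := (@lebesgue_measure R).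
Local Open Scope ereal_scope.

Lemma measurable_band (e a : R) (F : R -> R) : measurable_fun setT F ->
  measurable_fun setT (fun r : R => (F (a * r) * ppow e (1 - r ^+ 2))%:E).
Proof.
move=> mF; apply/measurable_EFinP/measurable_funM; last first.
  exact: (@measurable_ppowB _ _ _ e (cst 1%R) id).
by apply: measurableT_comp => //; exact: measurable_funM.
Qed.

Lemma integral_band_norm (e a : R) (F : R -> R) :
  measurable_fun setT F -> (forall x, 0 <= F x)%R ->
  \int[mu]_r (F (`|a| * r) * ppow e (1 - r ^+ 2))%:E =
  \int[mu]_r (F (a * r) * ppow e (1 - r ^+ 2))%:E.
Proof.
move=> mF F0; have [a0|a0] := leP 0%R a; first by rewrite ger0_norm.
rewrite -[RHS]ge0_integral_opp; last 2 first.
- exact: measurable_band.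
- by move=> x; rewrite lee_fin mulr_ge0// ppow_ge0.
by apply: eq_integral => r _; rewrite ltr0_norm// sqrrN mulrN mulNr.
Qed.

Lemma ge0_integral_sum2 (N : nat) (h : 'I_N -> 'I_N -> R -> \bar R) :
  (forall i j, measurable_fun setT (h i j)) -> (forall i j x, 0 <= h i j x) ->
  \sum_(i < N) \sum_(j < N) \int[mu]_x h i j x =
  \int[mu]_x \sum_(i < N) \sum_(j < N) h i j x.
Proof.
move=> mh h0; rewrite ge0_integral_sum//; last 2 first.
- by move=> i; exact: (emeasurable_sum (index_enum _) (mh i)).
- by move=> i x _; apply: sume_ge0.
by apply: eq_bigr => i _; rewrite (@ge0_integral_sum _ _ _ mu setT measurableT _
  (h i) (mh i) (fun j x _ => h0 i j x)).
Qed.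

(* With nonnegative [f i j], bounded below in sum by [K], no integrability has to
   be carried through the induction. *)
Lemma band_positivity (d N : nat) (e K : R) (y : 'I_N -> 'rV[R]_d.+1)
    (f : 'I_N -> 'I_N -> R -> R) :
  ((d%:R - 2) / 2 < e)%R -> (0 <= K)%R ->
  (forall i j, measurable_fun setT (f i j)) ->
  (forall i j x, 0 <= f i j x)%R ->
  (forall t : 'I_N -> R, K <= \sum_(i < N) \sum_(j < N) f i j (t i - t j))%R ->
  K%:E * Vol e <= \sum_(i < N) \sum_(j < N)
    \int[mu]_r (f i j (enorm (y i - y j) * r) * ppow e (1 - r ^+ 2))%:E.
Proof.
(* The vectors have d + 1 coordinates, so (d - 2) / 2 is (dimension - 3) / 2. The exponent, the
   points and the functions all change in the induction, while [K] stays. *)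
elim: d e y f => [|d IH] e y f de K0 mf f0 Kf.
  under eq_bigr => i _ do under eq_bigr => j _ do
    rewrite enorm1E integral_band_norm//.
  rewrite ge0_integral_sum2; last 2 first.
  - by move=> i j; exact: measurable_band.
  - by move=> i j x; rewrite lee_fin mulr_ge0// ppow_ge0.
  rewrite -ge0_integralZl_EFin//; last 2 first.
  - by move=> x _; rewrite lee_fin ppow_ge0.
  - exact: measurable_ppow1.
  apply: ge0_le_integral => //.
  - by move=> r _; rewrite mule_ge0// lee_fin ?ppow_ge0.
  - by apply: measurable_funeM; exact: measurable_ppow1.
  - apply: emeasurable_sum => i; apply: emeasurable_sum => j.
    exact: measurable_band.
  move=> r _; under eq_bigr => i _ do rewrite sumEFin.
  rewrite sumEFin -EFinM lee_fin.
  under eq_bigr => i _ do rewrite -mulr_suml.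
  rewrite -mulr_suml ler_wpM2r ?ppow_ge0//.
  have := Kf (fun i => y i ord0 ord0 * r)%R; congr (_ <= _)%R.
  by apply: eq_bigr => i _; apply: eq_bigr => j _; rewrite !mxE mulrBl.
pose e' := (e - 2^-1)%R.
have ee' : (e' + 2^-1 = e)%R by rewrite subrK.
have de' : ((d%:R - 2) / 2 < e')%R.
  by move: de; rewrite /e' -natr1; lra.
have e'1 : (-1 < e')%R.
  by apply: le_lt_trans de'; have := ler0n R d; lra.
have V0 := Vol_gt0 e'.
have Vfin : Vol e' \is a fin_num.
  by rewrite ge0_fin_numE ?Vol_lty// ltW.
have V0' : (0 < fine (Vol e'))%R by rewrite fine_gt0// V0/= Vol_lty.
(* Multiplying by [Vol e'], positive and finite, turns each integral on the right into a disk
   integral through [disk_marginal]. *)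
suff : Vol e' * (K%:E * Vol e) <= Vol e' * (\sum_(i < N) \sum_(j < N)
    \int[mu]_r (f i j (enorm (y i - y j) * r) * ppow e (1 - r ^+ 2))%:E).
  by rewrite -(fineK Vfin) lee_pmul2l// fineK.
have m1 : measurable_fun setT (fun z : R => (ppow e (1 - z ^+ 2))%:E).
  exact: measurable_ppow1.
have p0 (z : R) : 0 <= (ppow e (1 - z ^+ 2))%:E by rewrite lee_fin ppow_ge0.
rewrite ge0_sume_distrr; last first.
  move=> i _; apply: sume_ge0 => j _; apply: integral_ge0 => r _.
  by rewrite lee_fin mulr_ge0// ppow_ge0.
under eq_bigr => i _.
  rewrite ge0_sume_distrr; last first.
    move=> j _; apply: integral_ge0 => r _.
    by rewrite lee_fin mulr_ge0// ppow_ge0.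
  under eq_bigr => j _.
    rewrite muleC -{1}ee'.
    rewrite -(@disk_marginal _ e' _ _ _ _ (mf i j) (f0 i j)
      (enorm_ge0 (tailv (y i - y j))) (enorm_ge0 _) (sqr_enorm_tailv (y i - y j))).
    rewrite disk_fibers// ee'.
  over.
over.
have mfib i j := measurable_disk_fiber e' (enorm (tailv (y i - y j)))
    ((y i - y j) ord0 ord0) (mf i j) (f0 i j).
have fib0 i j z : 0 <= \int[mu]_r (f i j (enorm (tailv (y i - y j)) *
    Num.sqrt (1 - z ^+ 2) * r + (y i - y j) ord0 ord0 * z) *
    ppow e' (1 - r ^+ 2))%:E.
  by apply: integral_ge0 => r _; rewrite lee_fin mulr_ge0// ppow_ge0.
rewrite ge0_integral_sum2; last 2 first.
- by move=> i j; apply: emeasurable_funM.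
- by move=> i j z; apply: mule_ge0.
(* The left side becomes the integral over z of the weight times [K%:E * Vol e'], so that both sides
   can be compared for each z. *)
rewrite muleCA muleA [X in X <= _]muleC -ge0_integralZr//; last first.
  by rewrite mule_ge0// ltW.
apply: ge0_le_integral => //.
- by move=> z _; rewrite mule_ge0// mule_ge0// ltW.
- by apply: emeasurable_funM.
- apply: emeasurable_sum => i; apply: emeasurable_sum => j.
  by apply: emeasurable_funM; [exact: m1|exact: mfib].
move=> z _.
under eq_bigr => i _ do rewrite -ge0_sume_distrr//.
rewrite -ge0_sume_distrr; last by move=> i _; apply: sume_ge0.
apply: lee_wpmul2l => //.
(* The fibre at z is the claim one dimension lower, for the tails scaled by the half-length of the
   chord. *)
have := IH e' (fun i => Num.sqrt (1 - z ^+ 2) *: tailv (y i))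
  (fun i j u => f i j (u + (y i - y j) ord0 ord0 * z)%R) de' K0.
have -> : \sum_(i < N) \sum_(j < N) \int[mu]_r (f i j (enorm (tailv (y i - y j)) *
    Num.sqrt (1 - z ^+ 2) * r + (y i - y j) ord0 ord0 * z) *
    ppow e' (1 - r ^+ 2))%:E =
  \sum_(i < N) \sum_(j < N) \int[mu]_r (f i j (enorm (
    Num.sqrt (1 - z ^+ 2) *: tailv (y i) - Num.sqrt (1 - z ^+ 2) *: tailv (y j)) *
    r + (y i - y j) ord0 ord0 * z) * ppow e' (1 - r ^+ 2))%:E.
  apply: eq_bigr => i _; apply: eq_bigr => j _; apply: eq_integral => r _.
  by rewrite -scalerBr -tailvB enormZ ?sqrtr_ge0// [(Num.sqrt _ * _)%R]mulrC.
apply => //.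
- move=> i j; apply: measurableT_comp => //; exact: measurable_funD.
(* The shift is a difference of a term in i and a term in j, so it is absorbed into the arbitrary
   reals [t]. *)
- move=> t; have := Kf (fun i => t i + y i ord0 ord0 * z)%R; congr (_ <= _)%R.
  by apply: eq_bigr => i _; apply: eq_bigr => j _; congr (f i j _); rewrite !mxE; ring.
Qed.

End band_positivity.

(** * The normalizing constant *)

Section Gamma_ratio.
Context {R : realType}.
Local Notation mu := (@lebesgue_measure R).

(** [Gint_Vol] transports finiteness: at b = 1/2 from [Gint 1] back to [Gint (1/2)], then upwards
    from b to b + 1/2, because [Vol] is positive. *)
Lemma Gint_half_lty n : (Gint (n.+1%:R / 2 : R) < +oo)%E.
Proof.
have step (b : R) : (Gint b < +oo -> Gint (b + 2^-1) < +oo)%E.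
  move=> fb; have /eqP := Gint_Vol b.
  apply: contraTT; rewrite -leNgt leye_eq => /eqP ->.
  rewrite gt0_mulye ?Vol_gt0// lt_eqF// -ge0_fin_numE; last first.
    by rewrite mule_ge0 ?lee_fin ?sqrtr_ge0// ltW// Gint_gt0.
  by rewrite fin_numM// ge0_fin_numE// ltW// Gint_gt0.
have half : (Gint (2^-1 : R) < +oo)%E.
  have spi : 0 < Num.sqrt (pi : R) by rewrite sqrtr_gt0 pi_gt0.
  have := Gint_Vol (2^-1 : R).
  have -> : 2^-1 + 2^-1 = 1 :> R by lra.
  move=> /eqP; apply: contraTT; rewrite -leNgt leye_eq => /eqP ->.
  rewrite gt0_muley ?lte_fin// gt_eqF// -ge0_fin_numE; last first.
    by rewrite mule_ge0// ltW// ?Gint_gt0// Vol_gt0.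
  have V : (Vol (2^-1 - 1 : R) < +oo)%E by apply: Vol_lty; lra.
  rewrite fin_numM// ge0_fin_numE// ?Gint1_lty// ?V// ltW// ?Gint_gt0//.
  by rewrite Vol_gt0.
elim: n => [|n IH]; first by rewrite mul1r.
by have := step _ IH; rewrite -[X in (_ + X)%R]mul1r -mulrDl natr1.
Qed.

(** This is [Gint_Vol] at b = (d - 1) / 2. The constant is thus twice the inverse mass of the
    weight, the 2 accounting for integration over half of [-1, 1]. *)
Lemma Gamma_ratio (d : nat) : (2 <= d)%N ->
  2 * Gamma (d%:R / 2) / (Num.sqrt pi * Gamma ((d%:R - 1) / 2)) =
  2 / fine (Vol ((d%:R - 3) / 2)) :> R.
Proof.
case: d => [//|[//|d]] _.
have -> : (d.+2%:R - 1 : R) = d.+1%:R by rewrite -natr1 addrK.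
rewrite !GammaE.
have Gfin n : Gint (n.+1%:R / 2 : R) \is a fin_num.
  by rewrite ge0_fin_numE ?Gint_half_lty// ltW// Gint_gt0.
have Gpos n : 0 < fine (Gint (n.+1%:R / 2 : R)).
  by rewrite fine_gt0// Gint_gt0 Gint_half_lty.
have e1 : -1 < (d.+2%:R - 3) / 2 :> R.
  by have := ler0n R d; rewrite -addn2 natrD; lra.
have Vfin : Vol ((d.+2%:R - 3) / 2 : R) \is a fin_num.
  by rewrite ge0_fin_numE ?Vol_lty// ltW// Vol_gt0.
have Vpos : 0 < fine (Vol ((d.+2%:R - 3) / 2 : R)).
  by rewrite fine_gt0// Vol_gt0 Vol_lty.
have spi : 0 < Num.sqrt (pi : R) by rewrite sqrtr_gt0 pi_gt0.
have := Gint_Vol (d.+1%:R / 2 : R).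
have -> : d.+1%:R / 2 + 2^-1 = d.+2%:R / 2 :> R.
  by rewrite -[in RHS]natr1 mulrDl mul1r.
have -> : d.+1%:R / 2 - 1 = (d.+2%:R - 3) / 2 :> R.
  by rewrite -[in RHS]natr1; field.
move=> /(congr1 fine); rewrite !fineM//= => ->.
by field; rewrite !gt_eqF.
Qed.

End Gamma_ratio.

(** * Weighted means of bounded functions *)

Section Rintegral_substitution.
Context {R : realType}.
Local Notation mu := (@lebesgue_measure R).

Lemma integral_scale (c : R) (g : R -> \bar R) : 0 < c ->
  measurable_fun setT g ->
  (c%:E * \int[mu]_x g (c * x)%R = \int[mu]_x g x)%E.
Proof.
move=> c0 mg; rewrite integralE [RHS]integralE.
rewrite -(ge0_integral_scale c0 (measurable_funepos mg) (funepos_ge0 g)).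
rewrite -(ge0_integral_scale c0 (measurable_funeneg mg) (funeneg_ge0 g)).
set P := (\int[mu]_x (g ^\+)%E (c * x)%R)%E; set N := (\int[mu]_x (g ^\-)%E (c * x)%R)%E.
rewrite (funepos_comp g (fun x => c * x)) (funeneg_comp g (fun x => c * x)).
rewrite -/P -/N.
have : (0 <= P)%E by exact: integral_ge0.
have : (0 <= N)%E by exact: integral_ge0.
(* No integrability is assumed: if both parts are infinite, each side is [-oo] by the convention for
   the difference. *)
case: P => [p| |]//; case: N => [q| |]// _ _.
- by rewrite -EFinB -!EFinM -EFinB mulrBr.
- by rewrite addeNy gt0_muleNy ?lte_fin// gt0_muley ?lte_fin// addeNy.
- by rewrite addye// gt0_muley ?lte_fin// -EFinM addye.
- by rewrite addeNy gt0_muleNy ?lte_fin// gt0_muley ?lte_fin.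
Qed.

Lemma integral_opp (g : R -> \bar R) : measurable_fun setT g ->
  (\int[mu]_x g (- x)%R = \int[mu]_x g x)%E.
Proof.
move=> mg; rewrite integralE [RHS]integralE.
rewrite (funepos_comp g -%R) (funeneg_comp g -%R).
by congr (_ - _)%E; [exact: (ge0_integral_opp (measurable_funepos mg) (funepos_ge0 g))|
  exact: (ge0_integral_opp (measurable_funeneg mg) (funeneg_ge0 g))].
Qed.

End Rintegral_substitution.

Section band.
Context {R : realType}.
Local Notation mu := (@lebesgue_measure R).

Definition band (e : R) (h : R -> R) : R :=
  \int[mu]_r (h r * ppow e (1 - r ^+ 2)).

Lemma Vol_fin_num (e : R) : -1 < e -> Vol e \is a fin_num.
Proof. by move=> e1; rewrite ge0_fin_numE ?Vol_lty// ltW// Vol_gt0. Qed.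

Lemma fine_Vol_gt0 (e : R) : -1 < e -> 0 < fine (Vol e).
Proof. by move=> e1; rewrite fine_gt0// Vol_gt0 Vol_lty. Qed.

Lemma integrable_ppow1 (e : R) : -1 < e ->
  mu.-integrable setT (fun r : R => (ppow e (1 - r ^+ 2))%:E).
Proof.
move=> e1; apply/integrableP; split; first exact: measurable_ppow1.
under eq_integral => r _ do rewrite gee0_abs ?lee_fin ?ppow_ge0//.
exact: Vol_lty.
Qed.

Lemma integrable_band (e M : R) (h : R -> R) : -1 < e ->
  measurable_fun setT h -> (forall r, `|h r| <= M) ->
  mu.-integrable setT (fun r : R => (h r * ppow e (1 - r ^+ 2))%:E).
Proof.
move=> e1 mh hM.
have := @integrableMl _ (measurableTypeR R) R mu setT measurableT _ h (integrable_ppow1 e1) mh.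
move=> H; have := H _; under [X in integrable _ _ X]eq_fun do rewrite -EFinM mulrC.
apply; exists M; split; first exact: num_real.
by move=> x Mx r _ /=; rewrite (le_trans (hM r))// ltW.
Qed.

(** It links means of bounded signed functions with the extended integrals of nonnegative functions
    in [band_positivity]. *)
Lemma band_affine (e M a b : R) (h : R -> R) : -1 < e ->
  measurable_fun setT h -> (forall r, `|h r| <= M) ->
  (\int[mu]_r ((a * h r + b) * ppow e (1 - r ^+ 2))%:E =
  (a * band e h + b * fine (Vol e))%:E)%E.
Proof.
move=> e1 mh hM.
have ih := integrable_band e1 mh hM; have iw := integrable_ppow1 e1.
under eq_integral => r _ do rewrite mulrDl EFinD -mulrA !EFinM.
rewrite integralD//; last 2 first.
- exact: integrableZl.
- exact: integrableZl.
rewrite !integralZl// EFinD !EFinM.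
by rewrite /band /Rintegral !fineK ?Vol_fin_num// (integrable_fin_num measurableT ih).
Qed.

Lemma band_cst (e c : R) : -1 < e -> band e (fun=> c) = c * fine (Vol e).
Proof.
move=> e1.
have := @band_affine e 0 0 c (fun=> 0) e1 (measurable_cst _).
move=> /(_ (fun=> _)); rewrite normr0 => /(_ (lexx _)).
move=> /(congr1 fine) /= H; rewrite -[RHS]add0r -(mul0r (band e (fun=> 0))) -H.
by congr fine; apply: eq_integral => r _; rewrite mul0r add0r.
Qed.

Lemma ppow_le (e e' s : R) : e <= e' -> s <= 1 -> ppow e' s <= ppow e s.
Proof.
by move=> ee' s1; rewrite /ppow; case: ifP => // s0; apply: ger_powR; rewrite ?s0.
Qed.

Lemma cvg_ppow (e : R) (en : R^nat) s : en @ \oo --> e ->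
  (ppow (en n) s) @[n --> \oo] --> ppow e s.
Proof.
move=> ene; rewrite /ppow; case: ifP => s0; last exact: cvg_cst.
rewrite /powR gt_eqF//.
apply: (@cvg_comp _ _ _ (fun n => en n * ln s) expR _ (nbhs (e * ln s))).
  by apply: cvgM => //; exact: cvg_cst.
exact: continuous_expR.
Qed.

(** Dominated convergence: on [0, 1] powers decrease in the exponent, so [M * ppow e (1 - r ^+ 2)]
    dominates all terms. The varying exponent serves the endpoint (d - 3) / 2, the varying functions
    serve continuity. *)
Lemma cvg_band (e M : R) (en : R^nat) (h : R -> R) (hn : nat -> R -> R) :
  -1 < e -> (forall n, e <= en n) -> en @ \oo --> e ->
  (forall n, measurable_fun setT (hn n)) -> measurable_fun setT h ->
  (forall n r, `|hn n r| <= M) ->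
  (forall r, (hn n r) @[n --> \oo] --> h r) ->
  band (en n) (hn n) @[n --> \oo] --> band e h.
Proof.
move=> e1 een ene mhn mh hnM hnh.
have hM r : `|h r| <= M.
  have : `|hn n r| @[n --> \oo] --> `|h r| by apply: cvg_norm.
  by move=> /cvgr_to_le; apply; apply: nearW.
have mw e' : measurable_fun setT (fun r : R => ppow e' (1 - r ^+ 2)).
  exact: (@measurable_ppowB _ _ _ e' (cst 1) id).
have H := @dominated_convergence _ (measurableTypeR R) R mu setT measurableT
  (fun n r => (hn n r * ppow (en n) (1 - r ^+ 2))%:E)
  (fun r => (h r * ppow e (1 - r ^+ 2))%:E)
  (fun r => (M * ppow e (1 - r ^+ 2))%:E).
have [|||||_ _] := H.
- by move=> n; apply/measurable_EFinP/measurable_funM; [exact: mhn|exact: mw].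
- by apply/measurable_EFinP/measurable_funM; [exact: mh|exact: mw].
- apply: aeW => r _; apply: cvg_EFin; first exact: nearW.
  by apply: cvgM; [exact: hnh|exact: cvg_ppow].
- have -> : (fun r => (M * ppow e (1 - r ^+ 2))%:E) =
      (fun r => (M%:E * (ppow e (1 - r ^+ 2))%:E)%E) by apply/funext => r; rewrite EFinM.
  by apply: integrableZl => //; exact: integrable_ppow1.
- apply: aeW => r n _; rewrite lee_fin normrM ler_pM//.
  rewrite ger0_norm ?ppow_ge0// ppow_le//.
  by rewrite gerBl sqr_ge0.
move=> cvgI; rewrite /band /Rintegral; apply: fine_cvg.
by rewrite fineK// (integrable_fin_num measurableT (integrable_band e1 mh hM)).
Qed.

Lemma band_half (e M : R) (h : R -> R) : -1 < e ->
  measurable_fun setT h -> (forall r, `|h r| <= M) ->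
  (forall r, h (- r) = h r) ->
  band e h = 2 * \int[mu]_(r in `[0, +oo[) (h r * ppow e (1 - r ^+ 2)).
Proof.
move=> e1 mh hM hN; set k := fun r : R => h r * ppow e (1 - r ^+ 2).
have ik : mu.-integrable setT (EFin \o k) := integrable_band e1 mh hM.
have mk : measurable_fun setT (EFin \o k) by case/integrableP : ik.
have ikS (A : set R) : measurable A -> mu.-integrable A (EFin \o k).
  by move=> mA; apply: integrableS ik.
have Ineg : \int[mu]_(r in `]-oo, 0[) k r = \int[mu]_(r in `]0, +oo[) k r.
  rewrite /Rintegral integral_mkcond [in RHS]integral_mkcond; congr fine.
  rewrite -[RHS]integral_opp; last first.
    by apply/(measurable_restrictT _ _).1 => //; exact: measurable_funTS.
  apply: eq_integral => r _; rewrite !patchE /k.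
  have [r0|r0] := ltP r 0.
    by rewrite !mem_set /= ?in_itv/= ?andbT ?oppr_gt0// hN sqrrN.
  by rewrite !memNset//= in_itv/= ?andbT ?oppr_gt0; apply/negP; rewrite -leNgt.
have -> : band e h = \int[mu]_(r in `]-oo, 0[) k r + \int[mu]_(r in `[0, +oo[) k r.
  rewrite -Rintegral_setU//=.
  - rewrite /band; congr Rintegral; apply/seteqP; split=> x //= _.
    by rewrite !in_itv/= andbT; have [|] := ltP x 0; [left|right].
  - by apply: ikS; apply: measurableU; exact: measurable_itv.
  - rewrite disj_set2E; apply/eqP; rewrite -subset0 => x []/=.
    by rewrite !in_itv/= andbT ltNge => /negP.
rewrite Ineg Rintegral_itv_obnd_cbnd//; first by rewrite mulr_natl mulr2n.
by apply: ikS.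
Qed.

Lemma band_itv (e M x : R) (h : R -> R) : -1 < e -> 0 < x ->
  measurable_fun setT h -> (forall r, `|h r| <= M) ->
  (forall r, h (- r) = h r) ->
  x^-1 * \int[mu]_(u in `[0, x]) (h u * (1 - u ^+ 2 / x ^+ 2) `^ e) =
  2^-1 * band e (fun r => h (x * r)).
Proof.
move=> e1 x0 mh hM hN.
have x2 : 0 < x ^+ 2 by rewrite exprn_gt0.
have mhx : measurable_fun setT (fun r => h (x * r)).
  by apply: measurableT_comp => //; exact: measurable_funM.
rewrite (@band_half e M)//; last by move=> r; rewrite mulrN hN.
rewrite mulrA mulVf// mul1r.
pose k u := h u * ppow e (1 - (u / x) ^+ 2).
have mk : measurable_fun setT k.
  apply: measurable_funM => //.
  apply: (@measurable_ppowB _ _ _ e (cst 1) (fun u : R => u / x)) => //.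
  exact: measurable_funM.
have Ek u : u \in `[0, x[%classic -> h u * (1 - u ^+ 2 / x ^+ 2) `^ e = k u.
  rewrite inE/= in_itv/= => /andP[u0 ux].
  rewrite /k /ppow expr_div_n subr_gt0 ltr_pdivrMr// mul1r.
  by rewrite ltrXn2r ?nnegrE// ltW.
have mI : measurable_fun `[0, x[%classic (fun u => h u * (1 - u ^+ 2 / x ^+ 2) `^ e).
  apply: (eq_measurable_fun k); last exact: measurable_funTS.
  by move=> u /Ek ->.
(* From x on the truncated weight is zero, so the domain may be extended to the half-line, which
   scaling preserves. *)
have -> : \int[mu]_(u in `[0, x]) (h u * (1 - u ^+ 2 / x ^+ 2) `^ e) =
          \int[mu]_(u in `[0, +oo[) k u.
  rewrite /Rintegral -integral_itv_bndo_bndc; last exact/measurable_EFinP.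
  rewrite [X in fine X = _]integral_mkcond [X in _ = fine X]integral_mkcond; congr fine.
  apply: eq_integral => u _; rewrite !patchE.
  have [u0|u0] := leP 0 u; last first.
    by rewrite !memNset//= in_itv/= ?andbT; apply/negP; rewrite leNgt u0.
  rewrite [u \in `[0, +oo[%classic]mem_set/= ?in_itv/= ?u0//.
  have [ux|ux] := ltP u x.
    by rewrite mem_set/= ?in_itv/= ?u0// Ek// inE/= in_itv/= u0.
  rewrite memNset/=; last by rewrite in_itv/= u0 ltNge ux.
  by rewrite /k ppow_eq0 ?mulr0// expr_div_n subr_le0 ler_pdivlMr// mul1r lerXn2r ?nnegrE// ltW.
have ikx : mu.-integrable setT (fun r => (h (x * r) * ppow e (1 - r ^+ 2))%:E).
  exact: integrable_band e1 mhx (fun r => hM _).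
rewrite /Rintegral integral_mkcond -(integral_scale x0); last first.
  by apply/(measurable_restrictT _ _).1 => //; exact/measurable_funTS/measurable_EFinP.
have -> : (\int[mu]_r ((EFin \o k) \_ `[0%R, +oo[) (x * r)%R =
    \int[mu]_(r in `[0%R, +oo[) (h (x * r) * ppow e (1 - r ^+ 2))%:E)%E.
  rewrite [RHS]integral_mkcond; apply: eq_integral => r _; rewrite !patchE.
  have [r0|r0] := leP 0 r; last first.
    by rewrite !memNset//= in_itv/= ?andbT ?pmulr_rge0//; apply/negP; rewrite -ltNge.
  rewrite !mem_set/= ?in_itv/= ?andbT ?pmulr_rge0//.
  by rewrite /k mulrAC divff ?gt_eqF// mul1r.
rewrite fineM//=; last first.
  by apply: integrable_fin_num => //; exact: integrableS ikx.
by rewrite mulrA mulVf ?gt_eqF// mul1r.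
Qed.

End band.

(** * Membership in the class *)

Section sequential_continuity.
Context {R : realType}.

(** Dominated convergence speaks of sequences. If continuity failed at q, choosing a bad point of
    [D] in each ball of radius 1 / (n + 1) would give a sequence contradicting [seqF]. *)
Lemma within_sequential_continuous (D : set (R * R)) (F : R * R -> R) :
  (forall q (u : nat -> R * R), D q -> (forall n, D (u n)) -> u @ \oo --> q ->
     F (u n) @[n --> \oo] --> F q) ->
  {within D, continuous F}.
Proof.
move=> seqF; apply/subspace_continuousP => q Dq; apply/cvgrPdist_lt => eps eps0.
apply/not_notP => nF.
have bad n : exists x, D x /\ ball q (n.+1%:R^-1) x /\ ~ `|F q - F x| < eps.
  apply/not_existsP => H; apply: nF; rewrite /within/=.
  apply/nbhs_ballP; exists n.+1%:R^-1; first by rewrite /= invr_gt0.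
  by move=> x qx Dx; apply/not_notP => nx; exact: (H x).
have [u uP] := choice bad.
have uq : u @ \oo --> q.
  apply/cvg_ballP => e e0; near=> n.
  have [_ [+ _]] := uP n; apply: le_ball; apply: ltW.
  by near: n; exact: (near_infty_natSinv_lt (PosNum e0)).
have /cvgrPdist_lt/(_ _ eps0)[n _ /(_ n (leqnn n))] :=
  seqF q u Dq (fun n => (uP n).1) uq.
by move=> /= ?; have [_ [_]] := uP n.
Unshelve. all: by end_near. Qed.

Lemma within_continuous_cvg (D : set (R * R)) (F : R * R -> R) T
    (G : set_system T) {FG : Filter G} (f : T -> R * R) q :
  {within D, continuous F} -> D q -> (forall x, D (f x)) -> f @ G --> q ->
  F (f x) @[x --> G] --> F q.
Proof.
move=> /subspace_continuousP cF Dq Df fq.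
apply: (@cvg_comp _ _ _ f F _ (within D (nbhs q))); last exact: cF.
move=> A /fq; rewrite /= /within/= => H.
by apply: (@filterS T G FG) H => x Hx; apply: Hx; exact: Df.
Qed.

End sequential_continuity.

(** * The geodesic distance on the sphere *)

Section geodesic.
Context {R : realType}.

Lemma dotvC n (x y : 'rV[R]_n) : dotv x y = dotv y x.
Proof. by apply: eq_bigr => i _; rewrite mulrC. Qed.

Lemma sphere_dotv m (s : 'rV[R]_m.+1) : sphere R m s -> dotv s s = 1.
Proof. by move=> /= s1; rewrite -sqr_enorm s1 expr1n. Qed.

(** Cauchy-Schwarz for unit vectors, from the nonnegative squared norms of s + t and s - t. *)
Lemma sphere_dotv_itv m (s t : 'rV[R]_m.+1) : sphere R m s -> sphere R m t ->
  -1 <= dotv s t <= 1.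
Proof.
move=> /sphere_dotv ss /sphere_dotv tt.
have := dotvv_ge0 (s + t); have := dotvv_ge0 (s - t).
have -> : dotv (s - t) (s - t) = dotv s s - 2 * dotv s t + dotv t t.
  rewrite /dotv mulr_sumr -sumrB -big_split/=; apply: eq_bigr => i _.
  by rewrite !mxE; ring.
have -> : dotv (s + t) (s + t) = dotv s s + 2 * dotv s t + dotv t t.
  rewrite /dotv mulr_sumr -!big_split/=; apply: eq_bigr => i _.
  by rewrite !mxE; ring.
by rewrite ss tt => ? ?; apply/andP; split; lra.
Qed.

Lemma geodesic_itv m (s t : 'rV[R]_m.+1) : sphere R m s -> sphere R m t ->
  0 <= geodesic s t <= pi.
Proof.
by move=> ss tt; have st := sphere_dotv_itv ss tt; rewrite acos_ge0 ?acos_lepi.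
Qed.

Lemma geodesicC m (s t : 'rV[R]_m.+1) : geodesic s t = geodesic t s.
Proof. by rewrite /geodesic dotvC. Qed.

Lemma geodesicxx m (s : 'rV[R]_m.+1) : sphere R m s -> geodesic s s = 0.
Proof. by move=> /sphere_dotv ss; rewrite /geodesic ss acos1. Qed.

(** Two coordinates suffice: (1, 0) and (cos theta, sin theta). The sphere of dimension 0 would only
    realize the distances 0 and pi. *)
Lemma geodesic_surj m (theta : R) : (1 <= m)%N -> 0 <= theta <= pi ->
  exists s t : 'rV[R]_m.+1,
    [/\ sphere R m s, sphere R m t & geodesic s t = theta].
Proof.
case: m => // m _ th.
pose v (a b : R) : 'rV[R]_m.+2 :=
  \row_i (if i == ord0 then a else if i == lift ord0 ord0 then b else 0).
have dv a b c d : dotv (v a b) (v c d) = a * c + b * d.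
  rewrite /dotv big_ord_recl big_ord_recl big1 ?addr0 ?mxE//.
  by move=> i _; rewrite !mxE /= mulr0.
exists (v 1 0), (v (cos theta) (sin theta)); split.
- by rewrite /sphere/= /enorm dv mulr1 mulr0 addr0 sqrtr1.
- by rewrite /sphere/= /enorm dv -!expr2 cos2Dsin2 sqrtr1.
- by rewrite /geodesic dv mul1r mul0r addr0 cosK.
Qed.

End geodesic.

(** * Positive definiteness of the weighted means *)

Section band_posdef.
Context {R : realType}.

(** Adding [|a i * a j|] to each term makes it nonnegative, as |g| <= 1, and bounds the sum below by
    [K], so [band_positivity] applies. The added constants contribute exactly [K * fine (Vol e)],
    which cancels. *)
Let band_posdef_gt (d N : nat) (e : R) (y : 'I_N -> 'rV[R]_d.+1) (a : 'I_N -> R)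
    (g : 'I_N -> 'I_N -> R -> R) :
  (d%:R - 2) / 2 < e ->
  (forall i j, measurable_fun setT (g i j)) -> (forall i j u, `|g i j u| <= 1) ->
  (forall t : 'I_N -> R, 0 <= \sum_i \sum_j a i * a j * g i j (t i - t j)) ->
  0 <= \sum_i \sum_j a i * a j * band e (fun r => g i j (enorm (y i - y j) * r)).
Proof.
move=> de mg g1 gpos.
have e1 : -1 < e by apply: le_lt_trans de; have := ler0n R d; lra.
pose f i j u := a i * a j * g i j u + `|a i * a j|.
pose K := \sum_i \sum_j `|a i * a j|.
have mf i j : measurable_fun setT (f i j).
  by apply: measurable_funD => //; exact: measurable_funM.
have f0 i j u : 0 <= f i j u.
  rewrite /f -lerBlDr sub0r; apply: lerNnormlW.
  by rewrite normrM ler_piMr.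
have K0 : 0 <= K by apply: sumr_ge0 => i _; exact: sumr_ge0.
have Kf t : K <= \sum_i \sum_j f i j (t i - t j).
  under [leRHS]eq_bigr => i _ do rewrite big_split/=.
  by rewrite big_split/= -/K lerDr.
have := band_positivity y de K0 mf f0 Kf.
have -> : (\sum_(i < N) \sum_(j < N) \int[lebesgue_measure]_r
    (f i j (enorm (y i - y j) * r) * ppow e (1 - r ^+ 2))%:E =
  (\sum_i \sum_j a i * a j * band e (fun r => g i j (enorm (y i - y j) * r)) +
    K * fine (Vol e))%:E)%E.
  rewrite mulr_suml -big_split/= -sumEFin; apply: eq_bigr => i _.
  rewrite mulr_suml -big_split/= -sumEFin; apply: eq_bigr => j _.
  rewrite -(@band_affine _ e 1 _ _ (fun r => g i j (enorm (y i - y j) * r)) e1)//.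
  by apply: measurableT_comp => //; exact: measurable_funM.
by rewrite -[X in (_ * X <= _)%E](fineK (Vol_fin_num e1)) -EFinM lee_fin lerDr.
Qed.

(* The endpoint [e = (d - 2) / 2] is the limit of the exponents above it. *)
Lemma band_posdef (d N : nat) (e : R) (y : 'I_N -> 'rV[R]_d.+1) (a : 'I_N -> R)
    (g : 'I_N -> 'I_N -> R -> R) :
  -1 < e -> (d%:R - 2) / 2 <= e ->
  (forall i j, measurable_fun setT (g i j)) -> (forall i j u, `|g i j u| <= 1) ->
  (forall t : 'I_N -> R, 0 <= \sum_i \sum_j a i * a j * g i j (t i - t j)) ->
  0 <= \sum_i \sum_j a i * a j * band e (fun r => g i j (enorm (y i - y j) * r)).
Proof.
move=> e1 de mg g1 gpos.
pose en n := e + harmonic n.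
have en_gt n : e < en n by rewrite ltrDl /harmonic/= invr_gt0.
have ene : en @ \oo --> e.
  by rewrite -[X in _ --> X]addr0; apply: cvgD; [exact: cvg_cst|exact: cvg_harmonic].
have cvgS : \sum_i \sum_j a i * a j *
      band (en n) (fun r => g i j (enorm (y i - y j) * r)) @[n --> \oo] -->
    \sum_i \sum_j a i * a j * band e (fun r => g i j (enorm (y i - y j) * r)).
  apply: cvg_big => [|i _]; first exact: add_continuous.
  apply: cvg_big => [|j _]; first exact: add_continuous.
  apply: cvgM; first exact: cvg_cst.
  have mh : measurable_fun setT (fun r => g i j (enorm (y i - y j) * r)).
    by apply: measurableT_comp => //; exact: measurable_funM.
  apply: (@cvg_band _ e 1 en _ (fun _ r => g i j (enorm (y i - y j) * r))) => //.
    by move=> n; exact: ltW.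
  by move=> r; exact: cvg_cst.
apply: (cvgr_to_ge cvgS); apply: nearW => n; apply: band_posdef_gt => //.
exact: le_lt_trans de (en_gt n).
Qed.

End band_posdef.

(** * Profiles of the class on the line and their weighted means *)

Section profile.
Context {R : realType} (m : nat) (psi : R -> R -> R).
Hypotheses (m1 : (1 <= m)%N) (psiP : classP (fun x : R => `|x|) m psi).

(** Positive definiteness at the points (x, s) and (0, t), with s and t at distance theta and
    coefficients 1 and b = 1 or -1, reads 2 + 2 b psi(x, theta) >= 0. *)
Lemma profile_le1 (x theta : R) : 0 <= x -> 0 <= theta <= pi -> `|psi x theta| <= 1.
Proof.
move=> x0 th; have [s [t [ss tt st]]] := geodesic_surj m1 th.
have [_ psi00 pd] := psiP.
have gen (b : R) : b ^+ 2 = 1 -> 0 <= 2 + 2 * (b * psi x theta).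
  move=> b1.
  have := pd 2%N (fun i => if i == ord0 then 1 else b)
    (fun i => if i == ord0 then (x, s) else (0, t)).
  have H i : ([set: R] `*` sphere R m) (if i == ord0 :> 'I_2 then (x, s) else (0, t)).
    by split => //; case: ifP.
  move=> /(_ H); rewrite !big_ord_recl !big_ord0/= !addr0 !subrr !normr0 subr0 sub0r normrN.
  rewrite ger0_norm// !geodesicxx// psi00 (geodesicC t s) st.
  by rewrite -(expr2 b) b1 !mul1r mulr1 => H2; apply: le_trans H2 _; lra.
have h1 := gen 1 (expr1n R 2); have h2 := gen (- 1) (etrans (sqrrN 1) (expr1n R 2)).
by rewrite ler_norml; apply/andP; split; lra.
Qed.

Lemma profile_cvg T (G : set_system T) {FG : Filter G} (f g : T -> R) (x theta : R) :
  0 <= x -> 0 <= theta <= pi ->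
  (forall i, 0 <= f i) -> (forall i, 0 <= g i <= pi) ->
  f @ G --> x -> g @ G --> theta ->
  psi (f i) (g i) @[i --> G] --> psi x theta.
Proof.
move=> x0 th f0 gth fx gt; have [cpsi _ _] := psiP.
apply: (@within_continuous_cvg _ _ _ _ G _ (fun i => (f i, g i)) (x, theta) cpsi).
- by split => /=; rewrite in_itv/= ?andbT.
- by move=> i; split => /=; rewrite in_itv/= ?andbT.
- exact: (@cvg_pair _ _ _ G (nbhs x) (nbhs theta) _ _ _ f g fx gt).
Qed.

(** The profile is controlled on [0, +oo[ only; the absolute value makes it an even continuous
    function on the whole line. *)
Lemma measurable_profile (theta : R) : 0 <= theta <= pi ->
  measurable_fun setT (fun u : R => psi `|u| theta).
Proof.
move=> th; apply: continuous_measurable_fun => u.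
apply: profile_cvg => //; last exact: cvg_cst.
exact: norm_continuous.
Qed.

Lemma measurable_profileM (c theta : R) : 0 <= theta <= pi ->
  measurable_fun setT (fun r : R => psi `|c * r| theta).
Proof.
move=> th; have mc : measurable_fun setT (fun r : R => c * r).
  exact: measurable_funM.
exact: (measurableT_comp (measurable_profile th) mc).
Qed.

Lemma profile_norm_le1 (theta u : R) : 0 <= theta <= pi -> `|psi `|u| theta| <= 1.
Proof. exact: profile_le1. Qed.

(** One formula covers x = 0 and x > 0, so continuity at x = 0 needs no separate argument. For x > 0
    the 2 of [Gamma_ratio] cancels the 1/2 of [band_itv]; at x = 0 the integrand is constant times
    the weight. *)
Lemma turning_bandsE (d : nat) (x theta : R) : (2 <= d)%N -> 0 <= x -> 0 <= theta <= pi ->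
  turning_bands d psi x theta =
  (fine (Vol ((d%:R - 3) / 2)))^-1 *
    band ((d%:R - 3) / 2) (fun r => psi `|x * r| theta).
Proof.
move=> d2 x0 th.
have e1 : -1 < (d%:R - 3) / 2 :> R.
  by have : (2%:R <= d%:R :> R) by [rewrite ler_nat]; lra.
have V0 := fine_Vol_gt0 e1.
rewrite /turning_bands; case: ifPn => [x_gt0|].
  rewrite Gamma_ratio//.
  have -> : \int[lebesgue_measure]_(u in `[0, x])
      (psi u theta * (1 - u ^+ 2 / x ^+ 2) `^ ((d%:R - 3) / 2)) =
    \int[lebesgue_measure]_(u in `[0, x])
      (psi `|u| theta * (1 - u ^+ 2 / x ^+ 2) `^ ((d%:R - 3) / 2)).
    apply: eq_Rintegral => u; rewrite inE/= in_itv/= => /andP[u0 _].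
    by rewrite ger0_norm.
  rewrite (@band_itv _ _ 1 x (fun u => psi `|u| theta))//; last 3 first.
  - exact: measurable_profile.
  - by move=> r; exact: profile_norm_le1.
  - by move=> r; rewrite normrN.
  by field; rewrite gt_eqF.
rewrite lt_neqAle x0 andbT negbK => /eqP <-.
have -> : (fun r => psi `|0 * r| theta) = (fun=> psi 0 theta).
  by apply/funext => r; rewrite mul0r normr0.
by rewrite band_cst// mulrCA mulVf ?mulr1// gt_eqF.
Qed.

End profile.

Theorem theorem4 (R : realType) (d d' : nat) (psi1 : R -> R -> R)
    (hd : (2 <= d)%N) (hd' : (1 <= d')%N)
    (hpsi1 : classP (fun x : R => `|x|) d' psi1) :
  classP (@enorm R d) d' (turning_bands d psi1).
Proof.
have e1 : -1 < (d%:R - 3) / 2 :> R.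
  by have : (2%:R <= d%:R :> R) by [rewrite ler_nat]; lra.
have V0 := fine_Vol_gt0 e1.
have [cpsi psi00 pd] := hpsi1.
split.
- pose F (q : R * R) := (fine (Vol ((d%:R - 3) / 2)))^-1 *
    band ((d%:R - 3) / 2) (fun r => psi1 `|q.1 * r| q.2).
  apply: (@subspace_eq_continuous _ _ _ F).
    move=> [x th]; rewrite inE => -[/=]; rewrite !in_itv/= andbT => x0 th0.
    by rewrite /from_subspace /F/= (turning_bandsE hd' hpsi1).
  apply: within_sequential_continuous => -[x th] u [/=].
  rewrite !in_itv/= andbT => x0 th0 uD uq.
  have u1 n : 0 <= (u n).1 by have [] := uD n; rewrite /= in_itv/= andbT.
  have u2 n : 0 <= (u n).2 <= pi by have [] := uD n; rewrite /= !in_itv/= andbT.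
  have u1x : (u n).1 @[n --> \oo] --> x.
    apply: (@cvg_comp _ _ _ u fst _ (nbhs (x, th))) => //; exact: cvg_fst.
  have u2t : (u n).2 @[n --> \oo] --> th.
    apply: (@cvg_comp _ _ _ u snd _ (nbhs (x, th))) => //; exact: cvg_snd.
  apply: cvgM; first exact: cvg_cst.
  (* The exponent is constant here; the functions converge pointwise by continuity of [psi1] and are
     bounded by 1. *)
  apply: (@cvg_band _ _ 1 (fun=> (d%:R - 3) / 2) (fun r => psi1 `|x * r| th)
    (fun n r => psi1 `|(u n).1 * r| (u n).2)) => //.
  + exact: cvg_cst.
  + by move=> n; exact: (measurable_profileM hpsi1).
  + exact: (measurable_profileM hpsi1).
  + by move=> n r; apply: (profile_le1 hd' hpsi1).
  + move=> r; apply: (profile_cvg hpsi1) => //.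
    by apply: cvg_norm; apply: cvgM => //; exact: cvg_cst.
- by rewrite /turning_bands ltxx.
(* With dimension d + 1 the exponent equals the bound (d - 2) / 2 of [band_posdef]: this is the
   endpoint case. *)
case: d hd e1 V0 => [//|d] hd e1 V0 N a p pP.
have th i j : 0 <= geodesic (p i).2 (p j).2 <= pi.
  by apply: geodesic_itv; [exact: (pP i).2|exact: (pP j).2].
under eq_bigr => i _ do under eq_bigr => j _ do
  rewrite (turning_bandsE hd' hpsi1) ?enorm_ge0// mulrCA.
under eq_bigr => i _ do rewrite -mulr_sumr.
rewrite -mulr_sumr; apply: mulr_ge0; first by rewrite invr_ge0 ltW.
apply: (@band_posdef _ _ _ _ (fun i => (p i).1) a
  (fun i j u => psi1 `|u| (geodesic (p i).2 (p j).2))) => //.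
- by rewrite -natr1; lra.
- by move=> i j; exact: (measurable_profile hpsi1).
- by move=> i j u; exact: (profile_le1 hd' hpsi1).
(* For reals [t i] this is positive definiteness of [psi1] at the points of the line paired with the
   same sphere components. *)
- move=> t; apply: (pd N a (fun i => (t i, (p i).2))) => i.
  by split => //; exact: (pP i).2.
Qed.
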